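(* Let $m,n$ be arbitrary non-negative integers. If $\tau$ is a topology on $\mathscr{C}_{m,n}^0$ such that $(\mathscr{C}_{m,n}^0,\tau)$ is a Hausdorff locally compact semitopological semigroup, then either $\tau$ is discrete or $\tau=\tau_{\mathsf{Ac}}$.
   Context: The bicyclic monoid $\mathscr{C}(p,q)$ is the monoid with identity $1$ generated by two elements $p,q$ subject only to the relation $pq=1$. Each of its elements is written uniquely as $q^ip^j$ with $i,j\in\mathbb{N}_0$ (non-negative integers). For fixed $m,n\in\mathbb{N}_0$, $\mathscr{C}_{m,n}$ denotes the semigroup $(\mathscr{C}(p,q),\ast_{m,n})$ with the same underlying set and with operation $a\ast_{m,n}b=a\,q^mp^n\,b$ (product on the right taken in $\mathscr{C}(p,q)$). $\mathscr{C}_{m,n}^0=\mathscr{C}_{m,n}\sqcup\{0\}$ is the semigroup $\mathscr{C}_{m,n}$ with an adjoined zero $0$. The topology $\tau_{\mathsf{Ac}}$ on $\mathscr{C}_{m,n}^0$ is the one in which every element of $\mathscr{C}_{m,n}$ is an isolated point and the family $\{U\subseteq\mathscr{C}_{m,n}^0 : 0\in U \text{ and } \mathscr{C}_{m,n}\setminus U \text{ is finite}\}$ is a base at $0$ (the Alexandroff one-point compactification of the discrete space $\mathscr{C}_{m,n}$ with remainder $\{0\}$). A semitopological semigroup is a topological space with a separately continuous semigroup operation. A space $X$ is locally compact if every point has an open neighbourhood with compact closure. *)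

(* Defs.v *)
From HB Require Import structures.
From mathcomp Require Import all_boot.
From mathcomp Require Import all_classical topology separation_axioms.

Set Implicit Arguments.
Unset Strict Implicit.
Unset Printing Implicit Defensive.

Local Open Scope classical_set_scope.
Local Open Scope quotient_scope.

Section PresentedMonoid.
Variables (A : choiceType) (R : seq A -> seq A -> Prop).

(* The least monoid congruence on the free monoid [seq A] containing [R]. *)
Inductive pres_cong : seq A -> seq A -> Prop :=
| pres_step u l r v : R l r -> pres_cong (u ++ l ++ v) (u ++ r ++ v)
| pres_refl u : pres_cong u u
| pres_sym u v : pres_cong u v -> pres_cong v u
| pres_trans v u w : pres_cong u v -> pres_cong v w -> pres_cong u w.

Definition pres_eqv : rel (seq A) := fun u v => `[< pres_cong u v >].

Lemma pres_eqv_refl : reflexive pres_eqv.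
Proof. by move=> u; apply/asboolP/pres_refl. Qed.

Lemma pres_eqv_sym : symmetric pres_eqv.
Proof. by move=> u v; apply/asboolP/asboolP => /pres_sym. Qed.

Lemma pres_eqv_trans : transitive pres_eqv.
Proof.
by move=> v u w /asboolP uv /asboolP vw; apply/asboolP/(pres_trans uv vw).
Qed.

Canonical pres_equiv := EquivRel pres_eqv
  pres_eqv_refl pres_eqv_sym pres_eqv_trans.

Definition presented_monoid : Type := {eq_quot pres_equiv}.
HB.instance Definition _ := Choice.on presented_monoid.

Definition pres_class (u : seq A) : presented_monoid := \pi_{eq_quot pres_equiv} u.

Definition pres_mul (x y : presented_monoid) : presented_monoid :=
  pres_class (repr (x : {eq_quot pres_equiv}) ++
              repr (y : {eq_quot pres_equiv})).

Lemma pres_classP u v : pres_class u = pres_class v <-> pres_cong u v.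
Proof.
split=> [/eqmodP/asboolP //|uv].
by apply/eqmodP/asboolP.
Qed.

Lemma pres_cong_cat u u' v v' :
  pres_cong u u' -> pres_cong v v' -> pres_cong (u ++ v) (u' ++ v').
Proof.
move=> uu' vv'; apply: (@pres_trans (u' ++ v)).
  elim: uu' => [a l r b lr|a|a b _|b a c _ + _].
  - by rewrite -!catA; exact: pres_step.
  - exact: pres_refl.
  - exact: pres_sym.
  - exact: pres_trans.
elim: vv' => [a l r b lr|a|a b _|b a c _ + _].
- by rewrite !(catA u'); exact: pres_step.
- exact: pres_refl.
- exact: pres_sym.
- exact: pres_trans.
Qed.

Lemma pres_reprK (x : presented_monoid) :
  pres_class (repr (x : {eq_quot pres_equiv})) = x.
Proof. exact: reprK. Qed.

Lemma pres_mulE u v :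
  pres_mul (pres_class u) (pres_class v) = pres_class (u ++ v).
Proof.
by apply/pres_classP/pres_cong_cat; apply/pres_classP; rewrite pres_reprK.
Qed.

Lemma pres_mulA : associative pres_mul.
Proof.
move=> x y z; rewrite -(pres_reprK x) -(pres_reprK y) -(pres_reprK z).
by rewrite !pres_mulE catA.
Qed.

Lemma pres_mul1 : left_id (pres_class [::]) pres_mul.
Proof. by move=> x; rewrite -(pres_reprK x) pres_mulE. Qed.

Lemma pres_mulr1 : right_id (pres_class [::]) pres_mul.
Proof. by move=> x; rewrite -(pres_reprK x) pres_mulE cats0. Qed.

HB.instance Definition _ := isMonoid.Build presented_monoid
  pres_mulA pres_mul1 pres_mulr1.

End PresentedMonoid.

(* The letter [true] stands for p and the letter [false] for q, so that the
   only relation is pq = 1. *)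
Definition bicyclic_relator (l r : seq bool) : Prop :=
  l = [:: true; false] /\ r = [::].

Definition bicyclic : Type := presented_monoid bicyclic_relator.
HB.instance Definition _ := Monoid.on bicyclic.

Definition bicyclic_p : bicyclic := pres_class bicyclic_relator [:: true].
Definition bicyclic_q : bicyclic := pres_class bicyclic_relator [:: false].

Lemma bicyclic_pq : (bicyclic_p * bicyclic_q = 1 :> bicyclic)%g.
Proof.
rewrite [LHS]pres_mulE; apply/pres_classP.
exact: (@pres_step _ _ [::] [:: true; false] [::] [::]).
Qed.

Definition bicyclic_variant (m n : nat) : Type := bicyclic.
HB.instance Definition _ m n := Choice.on (bicyclic_variant m n).

Definition variant_mul (m n : nat) (a b : bicyclic_variant m n) :
    bicyclic_variant m n :=
  ((a : bicyclic) * (bicyclic_q ^+ m * bicyclic_p ^+ n) * (b : bicyclic))%g.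

Lemma variant_mulA m n : associative (@variant_mul m n).
Proof. by move=> a b c; rewrite /variant_mul !mulgA. Qed.

HB.instance Definition _ m n := isSemigroup.Build (bicyclic_variant m n)
  (@variant_mulA m n).

(* [None] is the adjoined zero. *)
Definition adjoin_zero (S : Type) : Type := option S.
HB.instance Definition _ (S : choiceType) := Choice.on (adjoin_zero S).

Definition adjoin_zero_mul (S : semigroupType) (x y : adjoin_zero S) :
    adjoin_zero S :=
  match x, y with
  | Some a, Some b => Some (a * b)%g
  | _, _ => None
  end.

Lemma adjoin_zero_mulA (S : semigroupType) : associative (@adjoin_zero_mul S).
Proof. by move=> [a|] [b|] [c|] //=; rewrite mulgA. Qed.

HB.instance Definition _ (S : semigroupType) :=
  isSemigroup.Build (adjoin_zero S) (@adjoin_zero_mulA S).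

Record topology (X : Type) := Topology {
  opens : set_system X;
  opensT : opens setT;
  opensI : setI_closed opens;
  opens_bigcup : forall F : set_system X,
    F `<=` opens -> opens (\bigcup_(U in F) U)
}.

Lemma topology_ext (X : Type) (s t : topology X) : opens s = opens t -> s = t.
Proof.
case: s t => [a aT aI aU] [b bT bI bU] /= ab; subst b.
by congr Topology; exact: Prop_irrelevance.
Qed.

(* [X] equipped with the topology [tau]. *)
Definition space (X : Type) (tau : topology X) : Type := X.

Section Space.
Variables (X : choiceType) (tau : topology X).

HB.instance Definition _ := Choice.on (space tau).

Let space_bigU (I : Type) (f : I -> set (space tau)) :
  (forall i, opens tau (f i)) -> opens tau (\bigcup_i f i).
Proof.
move=> of_; have -> : \bigcup_i f i = \bigcup_(U in range f) U.
  by rewrite bigcup_image.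
by apply: opens_bigcup => _ [i _ <-].
Qed.

HB.instance Definition _ := isOpenTopological.Build (space tau)
  (opensT tau) (@opensI _ tau) space_bigU.

Lemma open_spaceE : @open (space tau) = opens tau.
Proof. by []. Qed.

End Space.

Definition discrete (X : Type) (tau : topology X) : Prop :=
  forall U : set X, opens tau U.

Definition semitopological (S : semigroupType) (tau : topology S) : Prop :=
  forall a : S,
    continuous ((fun x : S => a * x)%g : space tau -> space tau) /\
    continuous ((fun x : S => x * a)%g : space tau -> space tau).

Section Alexandroff.
Variable X : choiceType.

Definition alexandroff_opens : set_system (adjoin_zero X) :=
  [set U | U None -> finite_set (Some @^-1` (~` U))].

Lemma alexandroff_opensT : alexandroff_opens setT.
Proof. by move=> _; rewrite setCT preimage_set0. Qed.

Lemma alexandroff_opensI : setI_closed alexandroff_opens.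
Proof.
move=> U V oU oV [UN VN]; rewrite setCI preimage_setU finite_setU.
by split; [exact: oU|exact: oV].
Qed.

Lemma alexandroff_opens_bigcup (F : set_system (adjoin_zero X)) :
  F `<=` alexandroff_opens -> alexandroff_opens (\bigcup_(U in F) U).
Proof.
move=> oF [U FU UN]; apply: sub_finite_set (oF _ FU UN) => x /= nFx Ux.
by apply: nFx; exists U.
Qed.

Definition alexandroff : topology (adjoin_zero X) :=
  Topology alexandroff_opensT alexandroff_opensI alexandroff_opens_bigcup.

Lemma alexandroff_isolated (x : X) : opens alexandroff [set Some x].
Proof. by []. Qed.

Lemma alexandroff_nbhs_zero : nbhs (None : space alexandroff) =
  filter_from [set U | U None /\ finite_set (Some @^-1` (~` U))] id.
Proof.
apply/seteqP; split=> V [U].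
  by case=> oU UN UV; exists U => //; split=> //; exact: oU.
by case=> UN fU UV; exists U; split.
Qed.

Lemma compact_discrete (A : set (discrete_topology X)) :
  compact A = finite_set A.
Proof.
rewrite propeqE; split; last exact: finite_compact.
move=> cA; apply: contrapT => infA.
pose F : set_system (discrete_topology X) := [set B | finite_set (A `\` B)].
have FF : ProperFilter F.
  apply: Build_ProperFilter_ex => [B FB|].
    apply: contrapT => /forallNP B0; apply: infA.
    by apply: sub_finite_set FB => x Ax; split => //; exact: B0.
  split=> [|B C FB FC|B C BC].
  - by rewrite /F /= setDT.
  - by rewrite /F /= setDIr finite_setU.
  - by apply: sub_finite_set => x [Ax nC]; split => // /BC.
have FA : F A by rewrite /F /= setDv.
have [p [Ap clp]] := cA F FF FA.
have Fp : F (~` [set p]).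
  by apply: (@sub_finite_set _ _ [set p]) => // x [_] /contrapT.
by have [x [npx /npx]] := clp _ _ Fp (discrete_set1 p).
Qed.

Lemma alexandroffE : opens alexandroff =
  @open (one_point_compactification (discrete_topology X)).
Proof.
apply/seteqP; split=> U.
  move=> oU; rewrite openE => -[x|] Ux; rewrite /interior /=.
    by rewrite /nbhs /=; apply/principal_filterP.
  exists (Some @^-1` (~` U)).
    split; last exact: discrete_closed.
    by rewrite compact_discrete; exact: oU.
  by case=> [x|//] [[y /= /contrapT Uy [<-]]|].
rewrite openE => oU UN; have [C [+ _] CU] := oU _ UN.
rewrite compact_discrete => fC; apply: sub_finite_set fC => x /= nUx.
by apply: contrapT => nCx; apply: nUx; apply: CU; left; exists x.
Qed.

End Alexandroff.

(* Main.v *)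
Require Import Defs.
From mathcomp Require Import all_boot.
From mathcomp Require Import all_classical topology separation_axioms.
From mathcomp Require Import zify.

(** In the coordinates q^i p^j, left translation by q^a p^b has the form
    (k, l) |-> (a + (k - b), l + (b - k)) with truncated subtraction, and it is
    a left translation of C_{m,n} as soon as n <= b; symmetrically on the right.
    For s large, the fixed points of the translations by q^s p^s on either side
    form a closed set containing 0 and all but finitely many elements, so every
    nonzero element is isolated.  If 0 is not isolated, let K be a compact
    neighbourhood of 0.  Each neighbourhood of 0 contains all but finitely many
    points of K; applied to preimages of K under translations, this says that
    every translation maps all but finitely many points of K into K.  Unit shifts
    make membership in K eventually constant along each row and column, with
    one common value, so K is finite or cofinite.  As K is infinite, it is
    cofinite and the topology is the compact one. *)

Local Open Scope classical_set_scope.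
Local Open Scope quotient_scope.

(** * Normal forms in the bicyclic monoid *)

(* Left multiplication of q^i p^j by the letter [b], in exponents. *)
Definition bicyclic_step (b : bool) (x : nat * nat) : nat * nat :=
  if b then (if x.1 is i.+1 then (i, x.2) else (0, x.2.+1)) else (x.1.+1, x.2).

Definition bicyclic_exps (x : bicyclic) : nat * nat :=
  foldr bicyclic_step (0, 0) (repr (x : {eq_quot pres_equiv bicyclic_relator})).

Definition bicyclic_elt (i j : nat) : bicyclic :=
  pres_class bicyclic_relator (nseq i false ++ nseq j true).

(** Acting by q and then by p restores every pair of exponents, so the action of words respects pq =
    1. This makes normal forms unique. *)
Lemma foldr_bicyclic_step_cong u v x : pres_cong bicyclic_relator u v ->
  foldr bicyclic_step x u = foldr bicyclic_step x v.
Proof.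
elim=> [a l r b [-> ->]|a|a b _ ->|b a c _ -> _ ->] //.
by rewrite !foldr_cat /=; case: (foldr _ x b).
Qed.

Lemma foldr_bicyclic_step_nseq i j k l :
  foldr bicyclic_step (k, l) (nseq i false ++ nseq j true) =
  (i + (k - j), l + (j - k)).
Proof.
rewrite foldr_cat; have -> : foldr bicyclic_step (k, l) (nseq j true) =
    (k - j, l + (j - k)).
  elim: j => [|j IHj] /=; first by congr pair; lia.
  rewrite {}IHj /bicyclic_step /=.
  by case E: (k - j) => [|d]; congr pair; lia.
by elim: i => [|i IHi] //=; rewrite IHi.
Qed.

Lemma bicyclic_exps_class w :
  bicyclic_exps (pres_class bicyclic_relator w) =
  foldr bicyclic_step (0, 0) w.
Proof.
by apply/foldr_bicyclic_step_cong/pres_classP; rewrite pres_reprK.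
Qed.

Lemma bicyclic_eltK i j : bicyclic_exps (bicyclic_elt i j) = (i, j).
Proof.
by rewrite bicyclic_exps_class foldr_bicyclic_step_nseq sub0n subn0 addn0.
Qed.

Lemma bicyclic_class w : pres_class bicyclic_relator w =
  let x := foldr bicyclic_step (0, 0) w in bicyclic_elt x.1 x.2.
Proof.
elim: w => [|b w IHw] //=.
rewrite -cat1s -pres_mulE {}IHw; case: (foldr _ _ w) => i j /=.
rewrite pres_mulE; apply/pres_classP; case: b => /=; last exact: pres_refl.
case: i => [|i] /=; first exact: pres_refl.
exact: (@pres_step _ _ [::] [:: true; false] [::] _).
Qed.

Lemma bicyclic_expsK x :
  bicyclic_elt (bicyclic_exps x).1 (bicyclic_exps x).2 = x.
Proof. by rewrite -[RHS]pres_reprK [RHS]bicyclic_class. Qed.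

Lemma bicyclic_eltM i j k l :
  (bicyclic_elt i j * bicyclic_elt k l)%g =
  bicyclic_elt (i + (k - j)) (l + (j - k)).
Proof.
rewrite [LHS]pres_mulE bicyclic_class foldr_cat.
by rewrite (foldr_bicyclic_step_nseq k l 0 0) sub0n subn0 addn0
  foldr_bicyclic_step_nseq.
Qed.

Lemma bicyclic_elt_expg i j :
  (bicyclic_q ^+ i * bicyclic_p ^+ j)%g = bicyclic_elt i j.
Proof.
have expq : (bicyclic_q ^+ i)%g = bicyclic_elt i 0.
  elim: i => [|i IHi] //; rewrite expgS IHi.
  by rewrite (_ : bicyclic_q = bicyclic_elt 1 0) // bicyclic_eltM subn0.
have expp : (bicyclic_p ^+ j)%g = bicyclic_elt 0 j.
  elim: j => [|j IHj] //; rewrite expgS IHj.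
  by rewrite (_ : bicyclic_p = bicyclic_elt 0 1) // bicyclic_eltM subn0 addn1.
by rewrite expq expp bicyclic_eltM subn0 !addn0.
Qed.

(** * Translations of C_{m,n} in exponents *)

Lemma variant_mulE m n (x y : bicyclic_variant m n) :
  (x * y)%g = ((x : bicyclic) * bicyclic_elt m n * (y : bicyclic))%g.
Proof. by rewrite -bicyclic_elt_expg. Qed.

Lemma variant_left_translation m n a b : n <= b ->
  exists s : bicyclic_variant m n, forall k l,
    (s * (bicyclic_elt k l : bicyclic_variant m n))%g =
    bicyclic_elt (a + (k - b)) (l + (b - k)).
Proof.
(* Since n <= b, q^a p^(b-n+m) q^m p^n = q^a p^b. *)
move=> nb; exists (bicyclic_elt a (b - n + m)) => k l.
rewrite [LHS]variant_mulE !bicyclic_eltM.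
by congr bicyclic_elt; lia.
Qed.

Lemma variant_right_translation m n a b : m <= b ->
  exists s : bicyclic_variant m n, forall k l,
    ((bicyclic_elt k l : bicyclic_variant m n) * s)%g =
    bicyclic_elt (k + (b - l)) (a + (l - b)).
Proof.
move=> mb; exists (bicyclic_elt (b - m + n) a) => k l.
rewrite [LHS]variant_mulE !bicyclic_eltM.
by congr bicyclic_elt; lia.
Qed.

(** * Almost invariant predicates on pairs of exponents *)

(* Stability, up to finitely many points, under the left translations by
   q^a p^b; exchanging the two arguments of [P] gives the right translations. *)
Definition almost_invariant (n : nat) (P : nat -> nat -> bool) :=
  forall a b, n <= b -> exists N, forall k l, N <= k + l ->
    P k l -> P (a + (k - b)) (l + (b - k)).

(** Translations by q^n p^(n+1) and q^(n+1) p^n are mutually inverse unit shifts between k and k + 1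
    when k >= n. *)
Lemma almost_invariant_edges n P : almost_invariant n P ->
  exists N, forall k l, n <= k -> N <= k + l -> P k.+1 l = P k l.
Proof.
move=> invP; have [N1 down] := invP n n.+1 (leqnSn n).
have [N2 up] := invP n.+1 n (leqnn n).
exists (maxn N1 N2) => k l nk; rewrite geq_max => /andP[N1kl N2kl].
apply/idP/idP => Pkl.
  have := down k.+1 l (leqW N1kl) Pkl.
  by rewrite subSS subnKC // (eqP (_ : n.+1 - k.+1 == 0)) ?addn0 // subn_eq0.
have := up k l N2kl Pkl.
by rewrite addSn subnKC // (eqP (_ : n - k == 0)) ?addn0 // subn_eq0.
Qed.

Definition row_limit (P : nat -> nat -> bool) (k : nat) (c : bool) :=
  exists M, forall l, M <= l -> P k l = c.

(** With b = max(k, n), left translation by q^k' p^b sends row k into row k', adding b - k to the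
    second exponent. A limit [true] thus passes from any row to any other. *)
Lemma row_limit_unique n P k k' c c' : almost_invariant n P ->
  row_limit P k c -> row_limit P k' c' -> c = c'.
Proof.
move=> invP Pk Pk'; wlog suff: k k' c c' Pk Pk' / c -> c'.
  by move=> imp; apply/idP/idP; [exact: (imp k k')|exact: (imp k' k)].
case: Pk Pk' => M Pk [M' Pk'] ct.
have [N inv] := invP k' (maxn k n) (leq_maxr k n).
rewrite -(Pk' (N + M + M' + (maxn k n - k))); last lia.
have := inv k (N + M + M').
rewrite (eqP (_ : k - maxn k n == 0)) ?subn_eq0 ?leq_maxl // addn0.
by apply; [lia|rewrite Pk //; lia].
Qed.

Lemma row_limit_exists m P k : almost_invariant m (fun l i => P i l) ->
  exists c, row_limit P k c.
Proof.
move=> /almost_invariant_edges[N edge].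
exists (P k (m + N)), (m + N) => l; elim: l => [|l IHl].
  by rewrite leqn0 => /eqP->.
rewrite leq_eqVlt ltnS => /predU1P[->//|Nl].
by rewrite edge; [exact: IHl|lia|lia].
Qed.

Lemma row_limit_uniform P c B : (forall k, row_limit P k c) ->
  exists M, forall k l, k < B -> M <= l -> P k l = c.
Proof.
move=> Pc; elim: B => [|B [M IHB]]; first by exists 0.
have [M' PB] := Pc B; exists (maxn M M') => k l.
rewrite ltnS leq_eqVlt geq_max => /predU1P[->|kB] /andP[Ml M'l]; first exact: PB.
exact: IHB.
Qed.

Lemma almost_invariant_constant m n P :
  almost_invariant n P -> almost_invariant m (fun l k => P k l) ->
  exists c N, forall k l, N <= k + l -> P k l = c.
Proof.
move=> invL invR; have [c rown] := row_limit_exists m P n invR.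
have rows k : row_limit P k c.
  have [c' rowk] := row_limit_exists m P k invR.
  by rewrite (row_limit_unique n P n k c c').
have [N edge] := almost_invariant_edges n P invL.
have [M rowM] := rown.
(* Row n has limit c, and unit shifts carry this value to every row k >= n. *)
have quadrant k l : n <= k -> M + N <= l -> P k l = c.
  elim: k => [|k IHk].
    by rewrite leqn0 => /eqP n0 Ml; rewrite -n0 rowM //; lia.
  rewrite leq_eqVlt ltnS => /predU1P[<- Ml|nk Ml]; first by rewrite rowM //; lia.
  by rewrite edge ?IHk //; lia.
(* Columns are rows of the transposed predicate. The quadrant gives column M + N the limit c, which
   uniqueness spreads to all columns. *)
have cols l : row_limit (fun l k => P k l) l c.
  have [c' coll] := row_limit_exists n (fun l k => P k l) l invL.
  rewrite (row_limit_unique m _ (M + N) l c c' invR) //.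
  by exists n => k nk; exact: quadrant.
(* Only finitely many rows and columns lie outside the quadrant, so their thresholds have a common
   bound. *)
have [M1 row_bound] := row_limit_uniform P c n rows.
have [M2 col_bound] := row_limit_uniform _ c (M + N) cols.
exists c, (n + (M + N) + M1 + M2) => k l kl.
have [nk|kn] := leqP n k; last by apply: row_bound; lia.
have [Ml|lM] := leqP (M + N) l; last by apply: col_bound; lia.
exact: quadrant.
Qed.

(** * Finiteness and topological preliminaries *)

Lemma finite_set_bounded {T : choiceType} (A : set T) (f : T -> nat) :
  finite_set A -> exists N, forall x, A x -> f x < N.
Proof.
move=> /finite_seqP[s ->]; exists (\max_(x <- s) f x).+1 => x xs.
by rewrite ltnS; exact: leq_bigmax_seq.
Qed.

Lemma finite_bicyclic_box s t :
  finite_set [set x | (bicyclic_exps x).1 < s /\ (bicyclic_exps x).2 < t].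
Proof.
apply: sub_finite_set (finite_image (fun p => bicyclic_elt p.1 p.2)
  (finite_setX (finite_II s) (finite_II t))) => x xst.
by exists (bicyclic_exps x) => //; exact: bicyclic_expsK.
Qed.

Lemma finite_bicyclic_set N (A : set bicyclic) :
  (forall k l, N <= k + l -> ~ A (bicyclic_elt k l)) -> finite_set A.
Proof.
move=> AN; apply: sub_finite_set (finite_bicyclic_box N N) => x Ax.
suff : (bicyclic_exps x).1 + (bicyclic_exps x).2 < N by rewrite /=; lia.
by rewrite ltnNge; apply/negP => /AN; rewrite bicyclic_expsK.
Qed.

Lemma closed_fixpoints (T : topologicalType) (f : T -> T) :
  hausdorff_space T -> continuous f -> closed [set x | f x = x].
Proof.
move=> hT cf p clp; apply: hT => U V fpU pV.
have [y [fy [Uy Vy]]] : [set x | f x = x] `&` (f @^-1` U `&` V) !=set0.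
  by apply: clp; apply: filterI pV; exact: cf.
by exists y; split => //; rewrite -fy.
Qed.

(** If A is infinite, the sets containing all but finitely many points of A form a proper filter,
    and no isolated point is a cluster point of it. *)
Lemma compact_isolated_finite (T : topologicalType) (A : set T) :
  compact A -> (forall x, A x -> open [set x]) -> finite_set A.
Proof.
move=> cA oA; apply: contrapT => infA.
pose F : set_system T := [set B | finite_set (A `\` B)].
have FF : ProperFilter F.
  apply: Build_ProperFilter_ex => [B FB|].
    apply: contrapT => /forallNP B0; apply: infA.
    by apply: sub_finite_set FB => x Ax; split => //; exact: B0.
  split=> [|B C FB FC|B C BC].
  - by rewrite /F /= setDT.
  - by rewrite /F /= setDIr finite_setU.
  - by apply: sub_finite_set => x [Ax nC]; split => // /BC.
have [|p [Ap clp]] := cA F FF; first by rewrite /F /= setDv.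
have Fp : F (~` [set p]).
  by apply: (@sub_finite_set _ _ [set p]) => // x [_] /contrapT.
have pp : nbhs p [set p] by apply: open_nbhs_nbhs; split => //; exact: oA.
by have [x [npx /npx]] := clp _ _ Fp pp.
Qed.

Lemma hausdorff_finite_closed (T : topologicalType) (A : set T) :
  hausdorff_space T -> finite_set A -> closed A.
Proof.
move=> hT; move: A; apply/accessible_finite_set_closed.
exact: hausdorff_accessible.
Qed.

(** * Isolated points and the dichotomy *)

Lemma semitopological_isolated (m n : nat)
    (tau : topology (adjoin_zero (bicyclic_variant m n))) x :
  hausdorff_space (space tau) -> semitopological tau ->
  open ([set Some x] : set (space tau)).
Proof.
move=> hT sT; set i := (bicyclic_exps x).1; set j := (bicyclic_exps x).2.
(* The exponents n + i + 1 and m + j + 1 are large enough for the translations to exist, and exceed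
   i and j, so neither translation fixes x. *)
have [e eP] := variant_left_translation m n (n + i.+1) (n + i.+1) (leq_addr _ _).
have [f fP] := variant_right_translation m n (m + j.+1) (m + j.+1) (leq_addr _ _).
pose Z := adjoin_zero (bicyclic_variant m n).
pose fixl := [set y : space tau | ((Some e : Z) * y)%g = y].
pose fixr := [set y : space tau | (y * (Some f : Z))%g = y].
have closed_fix : closed (fixl `|` fixr).
  apply: closedU; apply: closed_fixpoints hT _.
    exact: (sT (Some e)).1.
  exact: (sT (Some f)).2.
(* The left translation fixes q^k p^l once k >= n + i + 1, the right one once l >= m + j + 1; a
   finite box remains. *)
have fin : finite_set (~` (fixl `|` fixr)).
  apply: sub_finite_set (finite_image Some
    (finite_bicyclic_box (n + i.+1) (m + j.+1))) => -[y|]; last by case; left.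
  move=> /not_orP[ey fy]; exists y => //; move: ey fy.
  rewrite /fixl /fixr /= -(bicyclic_expsK y) bicyclic_eltK /=.
  move: (bicyclic_exps y) => [k l] /= ey fy.
  split; rewrite ltnNge; apply/negP => le; [apply: ey|apply: fy].
    by rewrite [LHS](congr1 Some (eP k l)); congr (Some (bicyclic_elt _ _)); lia.
  by rewrite [LHS](congr1 Some (fP k l)); congr (Some (bicyclic_elt _ _)); lia.
set U := ~` (fixl `|` fixr) in fin.
have Ux : U (Some x).
  rewrite -[in Some x](bicyclic_expsK x) -/i -/j.
  case; [rewrite /fixl /= [LHS](congr1 Some (eP i j))|].
    by move=> [/(congr1 bicyclic_exps)]; rewrite !bicyclic_eltK => -[] ; lia.
  rewrite /fixr /= [LHS](congr1 Some (fP i j)).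
  by move=> [/(congr1 bicyclic_exps)]; rewrite !bicyclic_eltK => -[] ; lia.
have -> : [set Some x] = U `&` ~` (U `\ Some x).
  rewrite setCD setIUr setICr set0U; apply/seteqP; split=> y; last by case.
  by move=> ->.
apply: openI; first exact: closed_openC.
apply: closed_openC; apply: hausdorff_finite_closed hT _.
exact: finite_setD.
Qed.

Theorem theorem10 (m n : nat)
    (tau : topology (adjoin_zero (bicyclic_variant m n))) :
  hausdorff_space (space tau) ->
  locally_compact [set: space tau] ->
  semitopological tau ->
  discrete tau \/ tau = alexandroff (bicyclic_variant m n).
Proof.
move=> hT lcT sT.
have isolated x : open ([set Some x] : set (space tau)).
  exact: semitopological_isolated.
have open_noNone (U : set (space tau)) : ~ U None -> open U.
  move=> nU; rewrite (_ : U = \bigcup_(x in Some @^-1` U) [set Some x]).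
    by apply: bigcup_open => x _; exact: isolated.
  by apply/seteqP; split=> [[x|] Ux //|_ [x Ux ->]//]; exists x.
have [oNone|nNone] := pselect (open ([set None] : set (space tau))).
  left=> U; have [UN|] := pselect (U None); last exact: open_noNone.
  rewrite -open_spaceE (_ : U = [set None] `|` (U `\ None)).
    by apply: (@openU (space tau)) => //; apply: open_noNone => -[_ []].
  by rewrite setDUK // => _ ->.
right.
have := lcT None I; rewrite withinET => -[K nK [cK clK]].
have cofinite (V : set (space tau)) : nbhs (None : space tau) V ->
    finite_set [set x | K (Some x) /\ ~ V (Some x)].
  (* This part of K is compact and avoids 0, hence has only isolated points. *)
  move=> nV; have fin : finite_set (K `&` ~` V^°).
    apply: compact_isolated_finite => [|[x|] [_ ni] //].
      by apply: compact_closedI => //; apply: open_closedC; exact: open_interior.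
  apply: (sub_finite_set _ (finite_preimage (in2W (@Some_inj _)) fin)) => x [Kx nVx].
  by split => // /interior_subset.
pose P k l := `[< K (Some (bicyclic_elt k l)) >].
have translate (f : space tau -> space tau) (g : nat -> nat -> nat * nat) :
    continuous f -> f None = None ->
    (forall k l, f (Some (bicyclic_elt k l)) =
      Some (bicyclic_elt (g k l).1 (g k l).2)) ->
    exists N, forall k l, N <= k + l -> P k l -> P (g k l).1 (g k l).2.
  move=> cf fN fg.
  (* As [f] fixes 0, the preimage of K is a neighbourhood of 0, so [f] sends only finitely many
     points of K outside K. *)
  have nV : nbhs (None : space tau) (f @^-1` K) by apply: cf; rewrite fN.
  have [N boundN] := finite_set_bounded _
    (fun x => (bicyclic_exps x).1 + (bicyclic_exps x).2) (cofinite _ nV).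
  exists N => k l Nkl /asboolP Kkl; apply/asboolP; apply: contrapT => nK'.
  suff : k + l < N by lia.
  have := boundN (bicyclic_elt k l); rewrite bicyclic_eltK; apply.
  by split => //=; rewrite fg.
have invL : almost_invariant n P.
  move=> a b nb; have [s sP] := variant_left_translation m n a b nb.
  apply: (translate _ (fun k l => (a + (k - b), l + (b - k))) (sT (Some s)).1) => //.
  by move=> k l; rewrite /= -sP.
have invR : almost_invariant m (fun l k => P k l).
  move=> a b mb; have [s sP] := variant_right_translation m n a b mb.
  have [//||N PN] := translate _ (fun k l => (k + (b - l), a + (l - b))) (sT (Some s)).2.
    by move=> k l; rewrite /= -sP.
  by exists N => l k Nlk; apply: PN; rewrite addnC.
have [[] [N PN]] := almost_invariant_constant m n P invL invR; last first.
  have finK : finite_set [set x | K (Some x)].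
    apply: (finite_bicyclic_set N) => k l Nkl Kkl.
    by have := PN k l Nkl; rewrite /P asboolT.
  (* Removing the finitely many nonzero points of K from its interior would isolate 0. *)
  exfalso; apply: nNone.
  rewrite (_ : [set None] = K^° `&` ~` (Some @` [set x | K (Some x)])).
    apply: openI; first exact: open_interior.
    apply: closed_openC; apply: hausdorff_finite_closed hT _.
    exact: finite_image.
  apply/seteqP; split=> [_ ->|[x|//] [/interior_subset Kx []]]; last by exists x.
  by split => // -[].
have finKC : finite_set [set x | ~ K (Some x)].
  by apply: (finite_bicyclic_set N) => k l Nkl nKkl; apply/nKkl/asboolP; exact: PN.
(* An open set around 0 misses finitely many points of K, and only finitely many lie outside K.
   Conversely, a finite complement is closed. *)
apply/topology_ext/seteqP; split => U.
  move=> oU UN; have nU : nbhs (None : space tau) U by exact: open_nbhs_nbhs.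
  apply: (@sub_finite_set _ _ ([set x | ~ K (Some x)] `|`
    [set x | K (Some x) /\ ~ U (Some x)])) => [x nUx|].
    by have [Kx|] := pselect (K (Some x)); [right|left].
  by rewrite finite_setU; split => //; exact: cofinite.
move=> fU; have [UN|] := pselect (U None); last exact: open_noNone.
rewrite -open_spaceE -[U]setCK.
have -> : ~` U = Some @` (Some @^-1` (~` U)).
  by apply/seteqP; split=> [[x|//]|_ [x nUx <-]] //; exists x.
apply: closed_openC; apply: hausdorff_finite_closed hT _.
by apply: finite_image; exact: fU.
Qed.
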